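(* Let $\mathbb{F}_q$ be a finite field, let $V$ be a proper subgroup of the additive group $(\mathbb{F}_q,+)$, and let $\{b_1,\dots,b_s\}$ be a set of representatives of the cosets of $V$ in $\mathbb{F}_q$, so that $\mathbb{F}_q/V=\{\overline{b_1},\dots,\overline{b_s}\}$, where $\overline{b}=b+V$. Let $\overline{L}=\{\overline{b_{i_1}},\dots,\overline{b_{i_r}}\}$, $r\ge1$, be a proper subgroup of $\mathbb{F}_q/V$ (of order $r$). Let $1\le k<n$ and let $\alpha_1,\dots,\alpha_n$ be distinct elements of $\bigcup_{j=1}^{r}(b_{i_j}+V)\cup\{\infty\}$; put $\bm\alpha=(\alpha_1,\dots,\alpha_n)$. If $\eta\in\mathbb{F}_q^*$ satisfies $(-\eta)^{-1}\in\mathbb{F}_q\setminus\bigcup_{j=1}^{r}(b_{i_j}+V)$, then the twisted Reed-Solomon code $TRS_{k,n}[\bm\alpha,1,k-1,\eta]$ is MDS.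
   Context: For $\eta\in\mathbb{F}_q^*$ and distinct $\alpha_1,\dots,\alpha_n\in\mathbb{F}_q\cup\{\infty\}$, the twisted Reed-Solomon code with twist parameters $(t,h)=(1,k-1)$ is $$TRS_{k,n}[\bm\alpha,1,k-1,\eta]=\Big\{(f(\alpha_1),\dots,f(\alpha_n)) : f=\sum_{i=0}^{k-1}f_ix^i+\eta f_{k-1}x^{k},\ f_0,\dots,f_{k-1}\in\mathbb{F}_q\Big\}\subseteq\mathbb{F}_q^n,$$ where, for such $f$, the value $f(\infty)$ is defined to be the coefficient $f_{k-1}$ of $x^{k-1}$. A linear code of length $n$, dimension $k$ and minimum Hamming distance $d$ is MDS if $d=n-k+1$; here ''MDS'' means an MDS code of length $n$ and dimension $k$. *)

(* Defs.v *)
From HB Require Import structures.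
From mathcomp Require Import all_boot all_order all_algebra all_fingroup.

Set Implicit Arguments.
Unset Strict Implicit.
Unset Printing Implicit Defensive.

Import GRing.Theory.
Local Open Scope ring_scope.

(* MathComp: a finFieldType F is canonically a finGroupType for its addition, *)
(* so {group F} is the type of additive subgroups of F, and for V : {group F} *)
(* [set: F] / V and coset V b are the quotient F/V and the class b + V.       *)

Section Codes.

Variables (F : finFieldType) (n : nat).

Definition hamming_dist (x y : 'rV[F]_n) : nat :=
  #|[set i : 'I_n | x 0 i != y 0 i]|.

Definition is_min_dist (C : {set 'rV[F]_n}) (d : nat) : Prop :=
  (exists x y, [/\ x \in C, y \in C, x != y & hamming_dist x y = d]) /\
  (forall x y, x \in C -> y \in C -> x != y -> (d <= hamming_dist x y)%N).

Definition is_linear_code (C : {set 'rV[F]_n}) (k d : nat) : Prop :=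
  exists U : {vspace 'rV[F]_n},
    [/\ C = [set x | x \in U], \dim U = k & is_min_dist C d].

Definition is_MDS (C : {set 'rV[F]_n}) (k : nat) : Prop :=
  is_linear_code C k (n - k + 1).

End Codes.

Section TwistedReedSolomon.

Variables (F : finFieldType) (k n : nat).

(* rVpoly c is the polynomial c_0 + c_1 X + ... + c_(k-1) X^(k-1), and        *)
(* (rVpoly c)`_k.-1 is c_(k-1); only k >= 1 is meaningful.                    *)
Definition trs_poly (eta : F) (c : 'rV[F]_k) : {poly F} :=
  rVpoly c + (eta * (rVpoly c)`_k.-1) *: 'X^k.

(* option F is F with a point at infinity, None *)
Definition trs_eval (f : {poly F}) (a : option F) : F :=
  if a is Some x then f.[x] else f`_k.-1.

Definition TRS (alpha : 'I_n -> option F) (eta : F) : {set 'rV[F]_n} :=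
  [set \row_(i < n) trs_eval (trs_poly eta c) (alpha i) | c : 'rV[F]_k].

End TwistedReedSolomon.

Definition translate (F : finFieldType) (b : F) (V : {set F}) : {set F} :=
  [set b + v | v in V].

(* Main.v *)
Require Import Defs.
From HB Require Import structures.
From mathcomp Require Import all_boot all_order all_algebra all_fingroup.

Set Implicit Arguments.
Unset Strict Implicit.
Unset Printing Implicit Defensive.

Import GRing.Theory.
Local Open Scope ring_scope.

(* Let L be the union of the chosen cosets; it is an additive subgroup. Let f *)
(* be a nonzero twisted polynomial. If f_(k-1) = 0, then deg f <= k - 2 and f *)
(* has at most k - 1 zeros, infinity included. Otherwise infinity is not a    *)
(* zero, and k distinct zeros in L would be all the roots of f, so by Vieta   *)
(* their sum would be -1/eta, which is not in L. Hence f vanishes at most     *)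
(* k - 1 times, which is the MDS bound, and Singleton gives equality.         *)

(** The code is the image of the linear map [trs_word], and [is_MDS_of_zeros] reduces the MDS
    property to every nonzero word having fewer than [k] zeros. [trs_poly_zeros] supplies this
    bound, with [coef_pred_roots] as Vieta and [bigcup_translate_sum] keeping the sum of the roots
    in the coset union. The same bound makes the map injective, which gives dimension [k]. *)

Section LinearCodes.

Variables (F : finFieldType) (n : nat).

Lemma hamming_dist_subr0 (x y : 'rV[F]_n) :
  hamming_dist x y = hamming_dist (x - y) 0.
Proof.
by apply: eq_card => i; rewrite !inE !mxE subr_eq0.
Qed.

Lemma hamming_dist0 (x : 'rV[F]_n) :
  hamming_dist x 0 = (n - #|[set i | x 0%R i == 0%R]|)%N.
Proof.
rewrite -[X in (X - _)%N]card_ord -(cardC [set i | x 0 i == 0]) addKn.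
by apply: eq_card => i; rewrite !inE mxE.
Qed.

(* A k-dimensional subspace has a nonzero word vanishing on the first k - 1   *)
(* coordinates, so the lower bound on the weights is attained.                *)
Lemma is_MDS_of_zeros (U : {vspace 'rV[F]_n}) (k : nat) :
    (0 < k <= n)%N -> \dim U = k ->
    (forall x, x \in U -> x != 0 -> (#|[set i | x 0%R i == 0%R]| < k)%N) ->
  is_MDS [set x | x \in U] k.
Proof.
move=> /andP[k_gt0 le_kn] dimU zeros; exists U; split=> //.
have weight x : x \in U -> x != 0 -> (n - k + 1 <= hamming_dist x 0)%N.
  move=> Ux x0; rewrite hamming_dist0 addn1 ltn_sub2l //.
    exact: leq_trans (zeros x Ux x0) le_kn.
  exact: zeros.
split=> [|x y]; last first.
  rewrite !inE => Ux Uy neq_xy; rewrite hamming_dist_subr0.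
  by apply: weight; rewrite ?rpredB // subr_eq0.
have le_k1n : (k.-1 <= n)%N by apply: leq_trans le_kn; apply: leq_pred.
pose p : 'Hom('rV[F]_n, 'rV[F]_k.-1) := linfun (colsub (widen_ord le_k1n)).
(* Otherwise [p] would embed [U], of dimension [k], in a space of dimension [k.-1]. *)
have : (U :&: lker p)%VS != 0%VS.
  apply/eqP => /limg_dim_eq dimpU.
  have := dimvS (subvf (p @: U)); rewrite dimpU dimU dimvf /dim /= mul1n.
  by rewrite -ltnS prednK // ltnn.
rewrite -vpick0; set x := vpick _ => x0.
have /memv_capP[Ux] : x \in (U :&: lker p)%VS by apply: memv_pick.
rewrite memv_ker lfunE /= => /eqP px0.
exists x, 0; split; rewrite ?inE ?mem0v //.
apply/eqP; rewrite eqn_leq weight // andbT hamming_dist0 addn1.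
rewrite -subSn // -[X in (_ <= _ - X)%N](prednK k_gt0) subSS leq_sub2l //.
have injw : injective (widen_ord le_k1n) by move=> i j /(congr1 val) ij; apply: val_inj.
rewrite -[X in (X <= _)%N]card_ord -(card_imset _ injw).
apply/subset_leq_card/subsetP => _ /imsetP[i _ ->].
by have /rowP/(_ i) := px0; rewrite inE !mxE => ->.
Qed.

End LinearCodes.

Section CosetUnion.

Variables (F : finFieldType) (V : {group F}).

(** [coset V] is a morphism only on the normaliser of [V], which is the whole field because addition
    commutes. *)
Lemma additive_subgroup_norm (x : F) : x \in 'N(V)%g.
Proof.
apply: (subsetP (sub_abelian_norm (FinRing.zmod_abelian [set: F]) _)) => //.
Qed.

Lemma mem_bigcup_translate (r : nat) (c : 'I_r -> F) (x : F) :
  (x \in \bigcup_(j < r) translate (c j) V) =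
  (coset V x \in [set coset V (c j) | j : 'I_r]).
Proof.
apply/bigcupP/imsetP=> [[j _ /imsetP[v Vv ->]]|[j _ eq_x]]; exists j => //.
  exact: (coset_kerr (c j) Vv).
have [v Vv ->] := kercoset_rcoset (additive_subgroup_norm x)
                    (additive_subgroup_norm (c j)) eq_x.
by apply/imsetP; exists v; rewrite // FinRing.zmodMgE addrC.
Qed.

(** The union is the preimage of the subgroup [L] under the quotient map, hence closed under
    addition; the empty sum 0 lies over the identity. *)
Lemma bigcup_translate_sum (r : nat) (c : 'I_r -> F) (L : {group coset_of V})
    (rs : seq F) :
    L :=: [set coset V (c j) | j : 'I_r] ->
    {subset rs <= \bigcup_(j < r) translate (c j) V} ->
  \sum_(a <- rs) a \in \bigcup_(j < r) translate (c j) V.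
Proof.
move=> defL; rewrite mem_bigcup_translate -defL.
elim: rs => [|a rs IHrs] sub_rs; first by rewrite big_nil coset_id ?group1.
rewrite big_cons -FinRing.zmodMgE morphM ?additive_subgroup_norm //.
rewrite groupM //; last first.
  by apply: IHrs => x rs_x; apply: sub_rs; rewrite inE rs_x orbT.
by rewrite defL -mem_bigcup_translate sub_rs ?mem_head.
Qed.

End CosetUnion.

(** Vieta: with as many distinct roots as its degree, [p] is its leading coefficient times the
    product of the ['X - a]. *)
Lemma coef_pred_roots (R : fieldType) (p : {poly R}) (rs : seq R) :
    (0 < size rs)%N -> size p = (size rs).+1 -> all (root p) rs -> uniq rs ->
  p`_(size rs).-1 = - (lead_coef p * \sum_(a <- rs) a).
Proof.
move=> rs_gt0 sz_p rs_p uniq_rs.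
rewrite {1}(all_roots_prod_XsubC sz_p rs_p) ?uniq_rootsE // coefZ.
by rewrite coefPn_prod_XsubC -?lt0n // mulrN.
Qed.

Section TwistedPolynomials.

Variables (F : finFieldType) (k n : nat) (eta : F).

Lemma trs_poly_is_linear : linear (@trs_poly F k eta).
Proof.
move=> a u v; rewrite /trs_poly linearP coefD coefZ mulrDr !scalerDl.
by rewrite scalerDr scalerA mulrCA addrACA.
Qed.

Lemma trs_eval_is_linear (a : option F) :
  linear_for *%R ((@trs_eval F k)^~ a).
Proof.
by move=> c f g; case: a => [x|] /=; rewrite ?hornerE ?coefD ?coefZ.
Qed.

Definition trs_word (alpha : 'I_n -> option F) (c : 'rV[F]_k) : 'rV[F]_n :=
  \row_i trs_eval k (trs_poly eta c) (alpha i).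

Lemma trs_word_is_linear (alpha : 'I_n -> option F) :
  linear (trs_word alpha).
Proof.
move=> a u v; apply/rowP=> i.
by rewrite !mxE trs_poly_is_linear trs_eval_is_linear.
Qed.

HB.instance Definition _ (alpha : 'I_n -> option F) :=
  GRing.isLinear.Build F 'rV[F]_k 'rV[F]_n _ (trs_word alpha)
    (trs_word_is_linear alpha).

Hypothesis k_gt0 : (0 < k)%N.

Lemma size_rVpoly (c : 'rV[F]_k) : (size (rVpoly c) <= k)%N.
Proof. exact: size_poly. Qed.

Lemma coef_trs_poly (c : 'rV[F]_k) (i : nat) : (i < k)%N ->
  (trs_poly eta c)`_i = (rVpoly c)`_i.
Proof. by move=> lt_ik; rewrite coefD coefZ coefXn ltn_eqF // mulr0 addr0. Qed.

Lemma coef_trs_poly_k (c : 'rV[F]_k) :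
  (trs_poly eta c)`_k = eta * (rVpoly c)`_k.-1.
Proof.
by rewrite coefD coefZ coefXn eqxx mulr1 nth_default ?add0r ?size_rVpoly.
Qed.

Lemma size_trs_poly (c : 'rV[F]_k) : (size (trs_poly eta c) <= k.+1)%N.
Proof.
apply: leq_trans (size_polyD _ _) _; rewrite geq_max.
rewrite (leq_trans (size_rVpoly c) (leqnSn k)) /=.
by apply: leq_trans (size_scale_leq _ _) _; rewrite size_polyXn.
Qed.

(** The twist only affects degree [k], so [c] can be read off from the lower coefficients. *)
Lemma trs_poly_neq0 (c : 'rV[F]_k) : c != 0 -> trs_poly eta c != 0.
Proof.
apply: contraNneq => f0; rewrite -(rVpolyK c).
suff -> : rVpoly c = 0 by rewrite linear0.
apply/polyP => i; rewrite coef0; case: (ltnP i k) => [lt_ik|le_ki].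
  by rewrite -coef_trs_poly // f0 coef0.
by rewrite nth_default // (leq_trans (size_rVpoly c)).
Qed.

Lemma trs_poly_zeros (S : {set F}) (c : 'rV[F]_k) (A : {set option F}) :
    eta != 0 ->
    (forall rs : seq F, {subset rs <= S} -> \sum_(a <- rs) a \in S) ->
    (- eta)^-1 \notin S -> A \subset [set Some a | a in S] :|: [set None] ->
    c != 0 ->
    (forall a, a \in A -> trs_eval k (trs_poly eta c) a = 0) ->
  (#|A| < k)%N.
Proof.
move=> eta_neq0 sumS etaS sub_A c_neq0 zA.
set f := trs_poly eta c in zA; have f_neq0 : f != 0 by apply: trs_poly_neq0.
pose rs := enum [set a | Some a \in A].
have uniq_rs : uniq rs by apply: enum_uniq.
have rs_f : all (root f) rs.
  apply/allP => a; rewrite mem_enum inE => /zA /= fa0.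
  by rewrite /root fa0.
(* The boolean counts the possible zero at infinity as 0 or 1. *)
have cardA : (#|A| = size rs + (None \in A))%N.
  rewrite (cardsD1 None A) addnC -cardE; congr (_ + _)%N.
  rewrite -(card_imset [set a | Some a \in A] (@Some_inj _)).
  apply: eq_card => -[a|]; rewrite !inE /=; last by apply/esym/negP => /imsetP[].
  apply/idP/imsetP => [Aa|[b Ab [->]]]; last by rewrite inE in Ab.
  by exists a; rewrite ?inE.
have lt_rs := max_poly_roots f_neq0 rs_f uniq_rs.
have [fk0 | fk_neq0] := eqVneq f`_k.-1 0.
  (* The coefficient of degree [k] is [eta] times the vanishing one of degree [k.-1], so both top
     terms disappear. This leaves at most [k - 2] finite zeros, with room for infinity. *)
  have szf : (size f <= k.-1)%N.
    apply/leq_sizeP => i; rewrite leq_eqVlt => /orP[/eqP<- //|].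
    rewrite prednK // leq_eqVlt => /orP[/eqP<-|lt_ki].
      by rewrite coef_trs_poly_k -coef_trs_poly ?prednK // fk0 mulr0.
    by rewrite nth_default // (leq_trans (size_trs_poly c)).
  rewrite cardA -[X in (_ < X)%N](prednK k_gt0) ltnS.
  apply: leq_trans szf; apply: leq_trans lt_rs.
  by rewrite -addn1 leq_add2l leq_b1.
have -> : (#|A| = size rs)%N.
  rewrite cardA; case: (boolP (None \in A)) => [/zA /= f0|]; last by rewrite addn0.
  by rewrite f0 eqxx in fk_neq0.
have fk1 : f`_k = eta * f`_k.-1 by rewrite coef_trs_poly_k coef_trs_poly ?prednK.
(* The degree bound allows at most [k] finite zeros; only exactly [k] remains to be excluded. *)
rewrite ltn_neqAle -ltnS (leq_trans lt_rs (size_trs_poly c)) andbT.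
apply: contraNneq etaS => sz_rs.
have szf : size f = (size rs).+1.
  by apply/eqP; rewrite eqn_leq lt_rs sz_rs size_trs_poly.
have := coef_pred_roots _ szf rs_f uniq_rs; rewrite lead_coefE szf /= sz_rs.
(* The leading coefficient is [eta] times the nonzero coefficient of degree [k.-1], which therefore
   cancels from Vieta's formula. *)
move=> /(_ k_gt0); rewrite fk1 -mulrA mulrCA -mulrN -[LHS]mulr1 => /(mulfI fk_neq0).
move=> sum1; have -> : (- eta)^-1 = \sum_(a <- rs) a.
  have eta1 : - eta != 0 by rewrite oppr_eq0.
  by apply: (mulfI eta1); rewrite divff // mulNr.
apply: sumS => a; rewrite mem_enum inE => /(subsetP sub_A).
by rewrite !inE orbF => /imsetP[b Sb [->]].
Qed.

End TwistedPolynomials.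

Theorem theorem3p4 (F : finFieldType) (V : {group F}) (s : nat)
  (b : 'I_s -> F) (r : nat) (idx : 'I_r -> 'I_s)
  (Lbar : {group coset_of V}) (k n : nat) (alpha : 'I_n -> option F) (eta : F)
  (V_proper : V \proper [set: F])
  (b_distinct : injective (fun i : 'I_s => coset V (b i)))
  (b_cover : ([set: F] / V)%g = [set coset V (b i) | i : 'I_s])
  (r_ge1 : (1 <= r)%N)
  (idx_inj : injective idx)
  (Lbar_def : Lbar :=: [set coset V (b (idx j)) | j : 'I_r])
  (Lbar_proper : Lbar \proper ([set: F] / V)%g)
  (k_ge1 : (1 <= k)%N) (k_lt_n : (k < n)%N)
  (alpha_inj : injective alpha)
  (alpha_in : forall i : 'I_n,
     alpha i \in [set Some a | a in \bigcup_(j < r) translate (b (idx j)) V]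
                 :|: [set None])
  (eta_neq0 : eta != 0)
  (eta_out : (- eta)^-1 \notin \bigcup_(j < r) translate (b (idx j)) V) :
  is_MDS (TRS k alpha eta) k.
Proof.
have sumS := bigcup_translate_sum Lbar_def.
pose w := linfun (@trs_word F k n eta alpha).
have zeros (c : 'rV[F]_k) : c != 0 -> (#|[set i | w c 0%R i == 0%R]| < k)%N.
  move=> c0; rewrite -(card_imset _ alpha_inj).
  apply: (trs_poly_zeros k_ge1 eta_neq0 _ eta_out _ c0) => [rs||a].
  - exact: sumS.
  - by apply/subsetP => _ /imsetP[i _ ->].
  - by case/imsetP=> i; rewrite inE lfunE mxE => /eqP fi0 ->.
(* A nonzero [c] in the kernel would give a word with [n] zeros, and [n] exceeds [k]. *)
have w_inj : lker w = 0%VS.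
  apply/eqP; rewrite -subv0; apply/subvP => c; rewrite memv_ker memv0.
  apply: contraTT => /zeros; apply: contraTneq => ->.
  rewrite -leqNgt (leq_trans (ltnW k_lt_n)) // -[X in (X <= _)%N]card_ord.
  by apply/subset_leq_card/subsetP => i _; rewrite inE mxE.
have -> : TRS k alpha eta = [set x | x \in limg w].
  apply/setP=> x; rewrite inE.
  by apply/imsetP/memv_imgP => -[c _ ->]; exists c; rewrite ?memvf ?lfunE.
apply: is_MDS_of_zeros => [||x /memv_imgP[c _ ->] wc0].
- by rewrite k_ge1 ltnW.
- by rewrite limg_dim_eq ?w_inj ?capv0 // dimvf /dim /= mul1n.
- by apply: zeros; apply: contraNneq wc0 => ->; rewrite linear0.
Qed.
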